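(* Let $\nu$, $U_t(r)$ ($1\le r\le t\le\nu$) and $R_t$ be as in the context, in either of the two cases (A1) and (A2) described there, and let $Y_t:=U_t(R_t)$, $t=1,\dots,\nu$. Let $y_t(1),\dots,y_t(\ell_t)$ be the distinct points of the set $\{U_t(1),\dots,U_t(t)\}$ and let $$f_t(j):=\mathrm{P}\{Y_t=y_t(j)\}=\frac1t\sum_{r=1}^t\mathbf 1\{U_t(r)=y_t(j)\},\qquad j=1,\dots,\ell_t .$$ Let $\{b_t\}$ be given by $$b_1=-\infty,\qquad b_2=\sum_{j=1}^{\ell_\nu}y_\nu(j)f_\nu(j),\qquad b_{t+1}=\sum_{j=1}^{\ell_{\nu-t+1}}\big[b_t\vee y_{\nu-t+1}(j)\big]f_{\nu-t+1}(j),\quad t=2,\dots,\nu,$$ and let $\tau_*=\min\{1\le t\le\nu:\ Y_t>b_{\nu-t+1}\}$. Then $$\mathrm{E}\,Y_{\tau_*}=\sup_{\tau\in\mathscr T(\mathscr R)}\mathrm{E}\,Y_\tau=b_{\nu+1}.$$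
   Context: $X_1,X_2,\dots$ are independent identically distributed random variables with continuous distribution function, and $R_t:=\sum_{j=1}^t\mathbf 1(X_t\le X_j)$ is the relative rank of $X_t$. $\mathscr R_t=\sigma(R_1,\dots,R_t)$, $\mathscr R=(\mathscr R_t,1\le t\le\nu)$, and $\mathscr T(\mathscr R)$ is the set of stopping times $\tau$ with values in $\{1,\dots,\nu\}$ such that $\{\tau=t\}\in\mathscr R_t$ for all $1\le t\le\nu$. $x\vee y=\max(x,y)$. For a reward function $q$ and $1\le r\le t\le k$, put $$I_{t,k}(r):=\sum_{a=r}^{k-t+r}q(a)\frac{\binom{a-1}{r-1}\binom{k-a}{t-r}}{\binom kt}.$$ Case (A1) (fixed horizon): $n$ is a positive integer, $q:\{1,\dots,n\}\to\mathbb R$, $\nu=n$ and $U_t(r)=I_{t,n}(r)$. Case (A2) (random horizon): $N$ is a positive integer-valued random variable independent of $\{X_t\}$, with $\gamma_k=\mathrm{P}(N=k)$, $k=1,\dots,N_{\max}$, $N_{\max}\le\infty$, and $q:\{0\}\cup\{1,\dots,N_{\max}\}\to[0,\infty)$, $q(0)=0$. If $N_{\max}<\infty$ then $\nu=N_{\max}$; if $N_{\max}=\infty$ then $\nu=\tilde N_{\max}$, where for a given $\epsilon>0$ the positive integer $\tilde N_{\max}$ is the minimal integer such that $\sup_t\max_{1\le r\le t}\sum_{k\ge t,\ k\ge\tilde N_{\max}+1}\gamma_k|I_{t,k}(r)|\le\epsilon$ (assumed to exist). In both subcases $U_t(r)=\sum_{k=t}^{\nu}\gamma_kI_{t,k}(r)$.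 *)

(* Defs.v *)
From HB Require Import structures.
From mathcomp Require Import all_boot all_order all_algebra finmap.
From mathcomp Require Import all_classical all_reals all_analysis.

Set Implicit Arguments.
Unset Strict Implicit.
Unset Printing Implicit Defensive.

Import Order.TTheory GRing.Theory Num.Theory.
Import numFieldNormedType.Exports.

Local Open Scope classical_set_scope.
Local Open Scope ring_scope.

Definition least (A : set nat) (n : nat) : Prop :=
  A n /\ forall m, A m -> (n <= m)%N.

Section Observations.
Context d (T : measurableType d) (R : realType) (P : probability T R).

Definition sigma_of d' (T' : measurableType d') (A : set nat)
    (Z : nat -> T -> T') : set (set T) :=
  <<s \bigcup_(i in A) preimage_set_system setT (Z i) measurable >>.

(* Sequences are indexed from 1; X 0 is unconstrained and never used. *)
Definition mutually_independent (X : nat -> {RV P >-> R}) : Prop :=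
  forall (J : {fset nat}) (B : nat -> set R),
    (forall j, j \in J -> (1 <= j)%N /\ measurable (B j)) ->
    P (\bigcap_(j in [set` J]) (X j @^-1` B j)) =
      (\prod_(j <- J) P (X j @^-1` B j))%E.

Definition identically_distributed (X : nat -> {RV P >-> R}) : Prop :=
  forall i j, (1 <= i)%N -> (1 <= j)%N ->
    forall B, measurable B -> distribution P (X i) B = distribution P (X j) B.

Definition iid_continuous (X : nat -> {RV P >-> R}) : Prop :=
  [/\ mutually_independent X, identically_distributed X &
      continuous (cdf (X 1%N))].

Definition independent_of (N : {RV P >-> nat}) (X : nat -> {RV P >-> R}) :
    Prop :=
  forall (A : set nat) (E : set T),
    sigma_of [set i | (1 <= i)%N] X E ->
    P (N @^-1` A `&` E) = (P (N @^-1` A) * P E)%E.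

Definition relrank (X : nat -> {RV P >-> R}) (t : nat) (w : T) : nat :=
  (\sum_(1 <= j < t.+1) ((X t w <= X j w)%R : nat))%N.

Definition history (X : nat -> {RV P >-> R}) (t : nat) : set (set T) :=
  sigma_of [set s | (1 <= s <= t)%N] (relrank X).

Definition stopping_times (X : nat -> {RV P >-> R}) (nu : nat) :
    set (T -> nat) :=
  [set tau | (forall w, (1 <= tau w <= nu)%N) /\
             (forall t, (1 <= t <= nu)%N -> history X t (tau @^-1` [set t]))].

End Observations.

Section Rewards.
Context (R : realType).

Definition expected_reward (q : nat -> R) (t k r : nat) : R :=
  \sum_(r <= a < (k - t + r).+1)
    q a * ('C(a.-1, r.-1) * 'C(k - a, t - r))%:R / 'C(k, t)%:R.

Definition truncation_error (gamma q : nat -> R) (m : nat) : \bar R :=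
  ereal_sup
    [set (\big[maxe/-oo]_(1 <= r < t.+1)
            \sum_(m.+1 <= k <oo | (t <= k)%N)
              (gamma k * `|expected_reward q t k r|)%:E)%E
    | t in [set t | (1 <= t)%N]].

Definition random_horizon_reward (nu : nat) (gamma q : nat -> R)
    (t r : nat) : R :=
  \sum_(t <= k < nu.+1) gamma k * expected_reward q t k r.

End Rewards.

(* [problem X nu U]: the horizon nu and the reward functions U_t(r) arise from
   a fixed horizon, or from a random horizon N whose range is bounded by some
   N_max < oo or is not assumed bounded. A reward function q is total on nat,
   but only its values on the stated domain are constrained and used. *)
Variant problem d (T : measurableType d) (R : realType) (P : probability T R)
    (X : nat -> {RV P >-> R}) : nat -> (nat -> nat -> R) -> Prop :=
| FixedHorizon (n : nat) (q : nat -> R) :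
    (1 <= n)%N ->
    problem X n (fun t r => expected_reward q t n r)
| BoundedRandomHorizon (N : {RV P >-> nat}) (Nmax : nat) (q : nat -> R) :
    independent_of N X ->
    (forall w, (1 <= N w <= Nmax)%N) ->
    q 0%N = 0 -> (forall a, (1 <= a <= Nmax)%N -> 0 <= q a) ->
    problem X Nmax
      (random_horizon_reward Nmax (fun k => fine (P (N @^-1` [set k]))) q)
| UnboundedRandomHorizon (N : {RV P >-> nat}) (q : nat -> R) (eps : R)
    (nu : nat) :
    independent_of N X ->
    (forall w, (1 <= N w)%N) ->
    q 0%N = 0 -> (forall a, (1 <= a)%N -> 0 <= q a) ->
    0 < eps ->
    least [set m | (1 <= m)%N /\
             (truncation_error (fun k => fine (P (N @^-1` [set k]))) q m
                <= eps%:E)%E] nu ->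
    problem X nu
      (random_horizon_reward nu (fun k => fine (P (N @^-1` [set k]))) q).

Section Solution.
Context d (T : measurableType d) (R : realType) (P : probability T R).

Definition observed_reward (X : nat -> {RV P >-> R}) (U : nat -> nat -> R)
    (t : nat) (w : T) : R :=
  U t (relrank X t w).

(* [y t] lists the distinct points of {U_t(1), ..., U_t(t)}, in any order. *)
Definition distinct_points (U : nat -> nat -> R) (nu : nat)
    (y : nat -> seq R) : Prop :=
  forall t, (1 <= t <= nu)%N ->
    uniq (y t) /\ y t =i [seq U t r | r <- iota 1 t].

Definition pmass (Y : nat -> T -> R) (t : nat) (z : R) : \bar R :=
  P [set w | Y t w = z].

(* The value at 0 is never used. *)
Fixpoint threshold (Y : nat -> T -> R) (nu : nat) (y : nat -> seq R)
    (s : nat) : \bar R :=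
  match s with
  | 0 | 1 => -oo
  | 2 => (\sum_(z <- y nu) z%:E * pmass Y nu z)%E
  | t.+1 => (\sum_(z <- y (nu - t).+1)
               maxe (threshold Y nu y t) z%:E * pmass Y (nu - t).+1 z)%E
  end.

(* The first t in 1, ..., nu with Y_t > b_(nu - t + 1). Such a t exists since
   b_1 = -oo; [find] returns a position in [:: 1; ...; nu] counted from 0. *)
Definition tau_star (Y : nat -> T -> R) (nu : nat) (y : nat -> seq R)
    (w : T) : nat :=
  (find (fun t => (threshold Y nu y (nu - t).+1 < (Y t w)%:E)%E)
     (iota 1 nu)).+1.

Definition stopped (Y : nat -> T -> R) (tau : T -> nat) (w : T) : R :=
  Y (tau w) w.

End Solution.

(* Main.v *)
Require Import Defs.
From HB Require Import structures.
From mathcomp Require Import all_boot all_order all_algebra finmap.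
From mathcomp Require Import all_classical all_reals all_analysis.
From mathcomp Require Import zify.

(**
The relative ranks R_1, R_2, ... are independent, with R_t uniform on
{1, ..., t}; equivalently, every vector (r_1, ..., r_n) with 1 <= r_t <= t is
the rank vector of X_1, ..., X_n with probability 1/n!. Since these n!
probabilities sum to 1, the upper bound 1/n! is enough. Cut the line into m
cells of probability 1/m each. The cell indices of X_1, ..., X_n are
independent, they coincide for some pair with probability at most n^2/m, and
when they are distinct they have the same relative ranks as X_1, ..., X_n.
An injective map from n indices to m cells is determined by its image and its
relative ranks, so at most C(m, n) <= m^n/n! of the m^n cell vectors are
injective with the prescribed ranks. Hence the probability is at most
n^2/m + 1/n! for every m.

Expectations therefore become averages over a finite set of rank vectors, on
which a stopping time is a function that reads only the past coordinates. If
w_t denotes the value of continuing after time t, the average of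
"Y_tau if tau <= t, and w_t otherwise" is nonincreasing in t, because the next
coordinate is uniform given the past; it goes from the value b_(nu+1) at t = 0
to E Y_tau at t = nu, and it is constant for the threshold rule.
*)

Set Implicit Arguments.
Unset Strict Implicit.
Unset Printing Implicit Defensive.

Import Order.TTheory GRing.Theory Num.Theory.
Import numFieldNormedType.Exports.

Local Open Scope classical_set_scope.
Local Open Scope ring_scope.

(** * Rank vectors and relative ranks of injections *)

(* Coordinate t (counted from 0) stands for the value of R_(t+1) minus 1. *)
Definition rank_vector (n : nat) := {dffun forall t : 'I_n, 'I_t.+1}.

Lemma card_rank_vector n : #|{: rank_vector n}| = n`!.
Proof.
rewrite card_dep_ffun foldrE big_image /= fact_prod big_add1 /= big_mkord.
by apply: eq_bigr => t _; rewrite card_ord.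
Qed.

(** Coordinate s has type ['I_s.+1], so [c] is cast by [inZp]; at s = t the cast is the identity. *)
Definition shift_coord n (t : 'I_n) (c : 'I_t.+1) (r : rank_vector n) :
    rank_vector n :=
  [ffun s : 'I_n => if s == t then r s + inZp c else r s : 'I_s.+1].

Lemma shift_coord_inj n (t : 'I_n) c : injective (@shift_coord n t c).
Proof.
move=> r r' /ffunP e; apply/ffunP => s; have := e s; rewrite !ffunE.
by case: eqP => // _ /addIr.
Qed.

(* f does not see the cyclic shifts of coordinate t, and averaging over them
   replaces h (r t) by the mean of h. *)
Lemma sum_rank_coord (A : comPzRingType) n (t : 'I_n) (f : rank_vector n -> A)
    (h : 'I_t.+1 -> A) :
  (forall r r' : rank_vector n, (forall s, s != t -> r s = r' s) ->
     f r = f r') ->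
  t.+1%:R * (\sum_r f r * h (r t)) = (\sum_r f r) * \sum_j h j.
Proof.
move=> fE; transitivity (\sum_(c < t.+1) \sum_r f r * h (r t + c)).
  rewrite -[X in X%:R * _](card_ord t.+1) -sumr_const mulr_suml.
  apply: eq_bigr => c _; rewrite mul1r.
  rewrite (reindex_inj (@shift_coord_inj n t c)) /=.
  apply: eq_bigr => r _; congr (_ * h _).
    by apply: fE => s /negPf st; rewrite ffunE st.
  by rewrite ffunE eqxx valZpK.
rewrite exchange_big mulr_suml; apply: eq_bigr => r _.
by rewrite -mulr_sumr [in RHS](reindex_inj (addrI (r t))).
Qed.

(** For [a <= b] the elements of [S] from [b] on lie among those from [a] on; equal cardinals make
    the two sets equal, so [b <= a] as well. *)
Lemma card_ge_inj m (S : {set 'I_m}) (a b : 'I_m) : a \in S -> b \in S ->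
  #|[set x in S | (a <= x)%N]%SET| = #|[set x in S | (b <= x)%N]%SET| -> a = b.
Proof.
wlog ab : a b / (a <= b)%N => [W aS bS e|aS bS /eqP e].
  by case/orP: (leq_total a b) => ab; [|symmetry]; apply: W.
apply/val_inj/eqP; rewrite eqn_leq ab /=.
have sub : [set x in S | (b <= x)%N]%SET \subset [set x in S | (a <= x)%N]%SET.
  by apply/fintype.subsetP => x; rewrite !inE => /andP[-> /(leq_trans ab)].
have /eqP/setP/(_ a) :
    [set x in S | (b <= x)%N]%SET == [set x in S | (a <= x)%N]%SET.
  by rewrite eqEcard sub (eqP e) leqnn.
by rewrite !inE aS leqnn /=.
Qed.

Lemma inj_relranks_eq n m (k k' : {ffun 'I_n -> 'I_m}) :
  injective k -> injective k' ->
  [set k i | i : 'I_n]%SET = [set k' i | i : 'I_n]%SET ->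
  (forall t : 'I_n, #|[set j : 'I_n | (j <= t)%N && (k t <= k j)%N]%SET| =
             #|[set j : 'I_n | (j <= t)%N && (k' t <= k' j)%N]%SET|) ->
  k = k'.
Proof.
move=> kI k'I eS eC; apply/ffunP.
(* Downward induction on t: once the values after t agree, so does the set of
   the values up to t, in which k t is located by its rank. *)
suff H p : forall t : 'I_n, (n - t <= p)%N -> k t = k' t.
  by move=> t; exact: (H n _ (leq_subr _ _)).
elim: p => [|p IH] t tp.
  by have := ltn_ord t; rewrite -subn_gt0; case: (_ - _)%N tp.
have kk' (j : 'I_n) : (t < j)%N -> k j = k' j.
  by move=> tj; apply: IH; rewrite -ltnS (leq_trans _ tp)// ltn_sub2l.
pose D := [set j : 'I_n | (j <= t)%N]%SET.
(* A value [f j] with j <= t equals some [g i]; if t < i it would also be [f i], against the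
   injectivity of [f]. *)
have image_sub (f g : {ffun 'I_n -> 'I_m}) : injective f ->
    [set f i | i : 'I_n]%SET = [set g i | i : 'I_n]%SET ->
    (forall j : 'I_n, (t < j)%N -> f j = g j) -> f @: D \subset g @: D.
  move=> fI e fg; apply/fintype.subsetP => x /imsetP[j jD ->].
  have /imsetP[i _ fgi] : f j \in [set g i | i : 'I_n]%SET.
    by rewrite -e imset_f.
  have [it|ti] := leqP i t; first by rewrite fgi imset_f// inE.
  by move: jD; rewrite -(fg _ ti) in fgi; rewrite (fI _ _ fgi) inE leqNgt ti.
have eD : k @: D = k' @: D.
  apply/eqP; rewrite finset.eqEsubset !image_sub// => j tj.
  by rewrite kk'.
have cardE (f : {ffun 'I_n -> 'I_m}) : injective f ->
    #|[set j : 'I_n | (j <= t)%N && (f t <= f j)%N]%SET| =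
    #|[set x in f @: D | (f t <= x)%N]%SET|.
  move=> fI; rewrite -(card_imset _ fI); congr #|pred_of_set _|.
  apply/setP => x; rewrite !inE; apply/imsetP/andP => [[j]|[/imsetP[j]]].
    by rewrite inE => /andP[jt fj ->]; rewrite fj imset_f// inE.
  by rewrite inE => jt -> fj; exists j; rewrite // inE jt.
have tD : t \in D by rewrite inE.
apply: (@card_ge_inj _ (k @: D)); rewrite ?imset_f//.
  by rewrite eD imset_f.
by rewrite -(cardE _ kI) eC (cardE _ k'I) eD.
Qed.

(** * Random variables with finitely many values *)

Lemma measurable_finite d (T : measurableType d) (I : finType) (rho : T -> I)
    (b : pred I) :
  (forall i, measurable (rho @^-1` [set i])) -> measurable [set w | b (rho w)].
Proof.
move=> mrho.
rewrite (_ : [set w | _] = \bigcup_(i in [set i | b i]) rho @^-1` [set i]).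
  by apply: fin_bigcup_measurable => // i _; exact: mrho.
by apply/seteqP; split => [w bw|w [i bi wi] /=]; [exists (rho w)|rewrite wi].
Qed.

Section FiniteValued.
Context d (T : measurableType d) (R : realType) (P : probability T R).
Context (I : finType) (rho : T -> I).
Hypothesis mrho : forall i, measurable (rho @^-1` [set i]).

Lemma expectation_finite (g : I -> R) :
  ('E_P[fun w => g (rho w)] = \sum_i (g i)%:E * P (rho @^-1` [set i]))%E.
Proof.
rewrite unlock.
have gE w : (g (rho w))%:E =
    (\sum_i (g i)%:E * (\1_(rho @^-1` [set i]) w)%:E)%E :> \bar R.
  rewrite (bigD1 (rho w))//= big1 ?adde0 => [|i /eqP iw].
    by rewrite indicE mem_set// mule1.
  by rewrite indicE memNset ?mule0// => /= e; apply: iw.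
under eq_integral do rewrite gE.
rewrite integral_sum//; last first.
  by move=> i; apply: integrableZl => //; exact: integrable_indic.
apply: eq_bigr => i _; rewrite integralZl//; last exact: integrable_indic.
by rewrite integral_indic// setIT.
Qed.

Lemma probability_finite (b : pred I) :
  P [set w | b (rho w)] = (\sum_(i | b i) P (rho @^-1` [set i]))%E.
Proof.
rewrite -expectation_indic; last exact: measurable_finite.
rewrite (_ : \1__ = fun w => (b (rho w))%:R); last first.
  apply/funext => w; rewrite indicE; congr (_%:R).
  have [bw|/negP bw] := boolP (b (rho w)); first by rewrite mem_set.
  by rewrite memNset.
rewrite (expectation_finite (fun i => (b i)%:R)) [RHS]big_mkcond /=.
by apply: eq_bigr => i _; case: (b i); rewrite ?mul1e ?mul0e.
Qed.

End FiniteValued.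

(** * Counting collisions among maps into m cells *)

Lemma ffact_le_expn m n : (m ^_ n <= m ^ n)%N.
Proof.
rewrite ffact_prod -[X in (_ <= _ ^ X)%N]card_ord -prod_nat_const.
by apply: leq_prod => i _; exact: leq_subr.
Qed.

(** Free of division and subtraction, this bounds the share of non-injective maps among all m^n maps
    by n^2/m. *)
Lemma expn_le_ffact m n : (m * m ^ n <= m * m ^_ n + n ^ 2 * m ^ n)%N.
Proof.
elim: n => [|n IH]; first by rewrite expn0 ffactn0 leq_addr.
rewrite ffactnSr expnS; have := ffact_le_expn m n.
move: (m ^_ n)%N (m ^ n)%N IH => a b IH ab.
(* Only an inequality, because [m - n] truncates to 0 when m < n. *)
have mn : (m <= (m - n) + n)%N by lia.
have := leq_mul (leqnn m) IH; have := leq_mul (leqnn (m * a)) mn.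
have := leq_mul (leqnn (m * n)) ab; rewrite !expnS !expn0.
move: (m - n)%N => c; nia.
Qed.

(** * Cells of equal probability *)

Section Quantile.
Context d (T : measurableType d) (R : realType) (P : probability T R).
Variable Z : {RV P >-> R}.
Hypothesis cZ : continuous (cdf Z).

Lemma cdf_attained (v : R) : 0 < v < 1 -> exists x, cdf Z x = v%:E.
Proof.
move=> /andP[v0 v1]; pose G := fine \o cdf Z.
have GE x : (G x)%:E = cdf Z x by rewrite fineK// fin_num_measure.
have Gc : continuous G by move=> x; apply: fine_cvg; rewrite GE; exact: cZ.
have [a Ga] : exists a, G a < v.
  have /fine_cvg/cvgr_lt/(_ _ v0) := cvg_cdfNy0 Z.
  by apply: filter_ex.
have [b Gb] : exists b, v < G b.
  have /fine_cvg/cvgr_gt/(_ _ v1) := cvg_cdfy1 Z.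
  by apply: filter_ex.
have ab : a <= b.
  rewrite leNgt; apply/negP => /ltW/(cdf_nondecreasing Z).
  by rewrite -!GE lee_fin leNgt (lt_trans Ga).
have [||c _ Gc'] := IVT (f := G) (v := v) ab.
- exact: continuous_subspaceT.
- by rewrite ge_min (ltW Ga) le_max (ltW Gb) orbT.
- by exists c; rewrite -GE Gc'.
Qed.

Lemma quantile_cells m : (0 < m)%N -> exists K : R -> 'I_m,
  [/\ {homo K : x y / x <= y >-> (x <= y)%N},
      forall k, measurable (K @^-1` [set k]) &
      forall k, (P (Z @^-1` (K @^-1` [set k])) <= (m%:R^-1)%:E)%E].
Proof.
(* From here on [m] is the number of cut points, and there are m + 1 cells. *)
case: m => // m _.
have /choice[x xE] : forall k : nat, exists x, (0 < k <= m)%N ->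
    cdf Z x = (k%:R / m.+1%:R)%:E.
  move=> k; have [/andP[k0 km]|] := boolP (0 < k <= m)%N; last by exists 0.
  have [|x xE] := @cdf_attained (k%:R / m.+1%:R); last by exists x.
  by rewrite divr_gt0 ?ltr0n//= ltr_pdivrMr ?ltr0n// mul1r ltr_nat ltnS.
(* The first cut point at or above z is [x (f z).+1], and [f z] is [m] if there is none. Cell k thus
   lies strictly above [x k] and extends up to [x k.+1]; the first and last cells are unbounded. *)
pose f z := find (fun k => z <= x k.+1) (iota 0 m).
have f_lt z : (f z < m.+1)%N by rewrite ltnS -[leqRHS](size_iota 0) find_size.
have f_gt z k : (k < f z)%N -> x k.+1 < z.
  move=> kf; have := before_find 0%N kf.
  by rewrite nth_iota ?(leq_trans kf (f_lt _))// add0n ltNge => ->.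
have f_le z : (f z < m)%N -> z <= x (f z).+1.
  move=> fm; have := @nth_find _ 0%N (fun k => z <= x k.+1) (iota 0 m).
  by rewrite has_find size_iota nth_iota// => /(_ fm).
pose K z := Ordinal (f_lt z).
have K_homo : {homo K : x y / x <= y >-> (x <= y)%N}.
  move=> z z' zz' /=; rewrite leqNgt; apply/negP => ff.
  have := f_gt _ _ ff; rewrite ltNge (le_trans zz')// f_le//.
  by rewrite (leq_trans ff)// -ltnS f_lt.
have mK k : measurable (K @^-1` [set k]).
  apply: measurable_realfun.is_interval_measurable => z z' /= Kz Kz' u.
  move=> /andP[zu uz'].
  apply/val_inj/eqP; rewrite eqn_leq.
  by rewrite -{1}Kz' -Kz !K_homo.
exists K; split => // k.
have P_le u : P (Z @^-1` `]-oo, u]) = cdf Z u by [].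
pose A := Z @^-1` (K @^-1` [set k]).
(* [L] and [H] are the events that Z is at most the lower, respectively the upper, end of cell k,
   with the empty and the full event for a missing end. *)
pose L := if (k : nat) is k'.+1 then Z @^-1` `]-oo, x k'.+1] else set0.
pose H := if (k < m)%N then Z @^-1` `]-oo, x k.+1] else setT.
have mA : measurable A by exact: measurable_funPTI.
have mL : measurable L.
  by rewrite /L; case: (k : nat) => // k'; exact: measurable_funPTI.
have mH : measurable H.
  by rewrite /H; case: ifP => // _; exact: measurable_funPTI.
have PL : P L = (k%:R / m.+1%:R)%:E.
  have := ltn_ord k; rewrite /L; case: (k : nat) => [|k'] km.
    by rewrite measure0 mul0r.
  by rewrite P_le xE.
have PH : P H = (k.+1%:R / m.+1%:R)%:E.
  rewrite /H; case: ifP => km; first by rewrite P_le xE.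
  have -> : k = m :> nat by apply/eqP; rewrite eqn_leq -ltnS ltn_ord leqNgt km.
  by rewrite probability_setT divff// pnatr_eq0.
have AL : A `&` L = set0.
  rewrite -subset0 => w []; rewrite /A /L /= => <-.
  case E : (K (Z w) : nat) => [//|k'] /=; rewrite in_itv /= leNgt => /negP.
  by apply; apply: f_gt; rewrite -[f _]/(K (Z w) : nat) E.
have sAL : A `|` L `<=` H.
  rewrite /A /L /H; case: ifPn => // km w [/= Kw|].
    by rewrite in_itv /= -Kw; apply: f_le; rewrite -[f _]/(K (Z w) : nat) Kw.
  case E : (k : nat) => [//|k'] /=; rewrite !in_itv /= => /le_trans; apply.
  rewrite leNgt; apply/negP => /ltW /(cdf_nondecreasing Z).
  rewrite E in km; rewrite !xE //; last exact: ltnW.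
  by rewrite lee_fin ler_pM2r ?invr_gt0 ?ltr0n// ler_nat ltnn.
have : (P A + P L <= P H)%E.
  by rewrite -measureU// le_measure ?inE//; exact: measurableU.
have /fineK <- : P A \is a fin_num by rewrite fin_num_measure.
by rewrite PL PH -EFinD !lee_fin -lerBrDr -mulrBl -natrB// subSnn mul1r.
Qed.

End Quantile.

(** * The law of the relative ranks *)

(** Taking images is injective on these maps by [inj_relranks_eq], and each image is an n-element
    subset of ['I_m]. *)
Lemma card_inj_relranks n m (c : 'I_n -> nat) :
  (#|[set k : {ffun 'I_n -> 'I_m} | injectiveb k &&
       [forall t : 'I_n,
          #|[set j : 'I_n | (j <= t)%N && (k t <= k j)%N]%SET| == c t]]%SET|
     <= 'C(m, n))%N.
Proof.
set S := [set k | _]%SET.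
rewrite -[m in 'C(m, _)]card_ord -card_draws.
pose im (k : {ffun 'I_n -> 'I_m}) := [set k i | i : 'I_n]%SET.
rewrite -(card_in_imset (f := im)).
  apply/subset_leq_card/fintype.subsetP => _ /imsetP[k kS ->].
  move: kS; rewrite !inE => /andP[/injectiveP kI _].
  by rewrite card_imset// card_ord.
move=> k k'; rewrite !inE => /andP[/injectiveP kI /forallP kc].
move=> /andP[/injectiveP k'I /forallP k'c] e; apply: inj_relranks_eq => // t.
by rewrite (eqP (kc t)) (eqP (k'c t)).
Qed.

Section RankVector.
Context d (T : measurableType d) (R : realType) (P : probability T R).
Variable X : nat -> {RV P >-> R}.

Lemma relrankE n (t : 'I_n) w :
  relrank X t.+1 w =
    #|[set j : 'I_n | (j <= t)%N && (X t.+1 w <= X j.+1 w)]%SET|.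
Proof.
rewrite /relrank big_add1 /= big_mkord.
rewrite (big_ord_widen n (fun j => (X t.+1 w <= X j.+1 w)%R : nat))//.
rewrite -sum1_card [RHS]big_mkcond /= [LHS]big_mkcond /=.
by apply: eq_bigr => j _; rewrite inE ltnS; case: (j <= t)%N; case: (_ <= _).
Qed.

Lemma relrank_bounds t w : (0 < relrank X t.+1 w <= t.+1)%N.
Proof.
rewrite (relrankE (ord_max : 'I_t.+1)); apply/andP; split.
  by apply/card_gt0P; exists ord_max; rewrite inE leqnn lexx.
by rewrite -[leqRHS](card_ord t.+1) max_card.
Qed.

Lemma measurable_relrank t : measurable_fun setT (relrank X t).
Proof.
rewrite /relrank; elim: (index_iota _ _) => [|j s IH].
  by under eq_fun do rewrite big_nil; exact: measurable_cst.
under eq_fun do rewrite big_cons.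
apply: measurable_realfun.measurable_fun_addn => //.
apply: (@measurableT_comp _ _ _ _ _ _ nat_of_bool) => //.
exact: measurable_realfun.measurable_fun_ler.
Qed.

(** Since R_(t+1) lies between 1 and t + 1, [inord] never falls back on its default. *)
Definition rank_of n (w : T) : rank_vector n :=
  [ffun t : 'I_n => inord (relrank X t.+1 w).-1 : 'I_t.+1].

Lemma rank_ofE n w (t : 'I_n) : relrank X t.+1 w = (rank_of n w t).+1.
Proof.
have /andP[r0 r1] := relrank_bounds t w.
by rewrite ffunE inordK prednK.
Qed.

Lemma rank_of_eq n (r : rank_vector n) :
  rank_of n @^-1` [set r] =
  \bigcap_(t in [set: 'I_n]) (relrank X t.+1 @^-1` [set (r t).+1]).
Proof.
apply/seteqP; split => [w /= <- t _ /=|w H /=]; first by rewrite rank_ofE.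
by apply/ffunP => t; apply/val_inj/succn_inj; rewrite -rank_ofE H.
Qed.

Lemma measurable_rank_of n (r : rank_vector n) :
  measurable (rank_of n @^-1` [set r]).
Proof.
rewrite rank_of_eq; apply: fin_bigcap_measurable => // t _.
by rewrite -[X in measurable X]setTI; exact: measurable_relrank.
Qed.

Hypothesis iidX : iid_continuous X.

Lemma independent_prefix n (B : nat -> set R) : (forall i, measurable (B i)) ->
  P (\bigcap_(i in `I_n) (X i.+1 @^-1` B i)) =
    (\prod_(i < n) P (X i.+1 @^-1` B i))%E.
Proof.
move=> mB; have [indX _ _] := iidX.
have := indX [fset i.+1 | i in iota 0 n]%fset (fun j => B j.-1).
rewrite big_imfset /=; last by move=> i j _ _ [].
rewrite undup_id ?iota_uniq// -[in iota 0 n](subn0 n) big_mkord => <-.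
- congr (P _); apply/seteqP; split => [w H j /= /imfsetP[i /= ]|w H i /= ni].
    by rewrite mem_iota subn0 => ni ->; exact: (H i).
  by apply: (H i.+1) => /=; apply/imfsetP; exists i; rewrite //= mem_iota subn0.
- by move=> j /imfsetP[i _ ->].
Qed.

(** Each cell vector has probability at most m^-n. The numerator counts the vectors with a collision
    and adds the bound C(m, n) on the injective ones whose ranks are [r]. *)
Lemma rank_vector_prob_le n m (r : rank_vector n) : (0 < m)%N ->
  (P (rank_of n @^-1` [set r]) <=
    (((m ^ n - m ^_ n) + 'C(m, n))%:R / (m ^ n)%:R)%:E)%E.
Proof.
move=> m0; have [indX idX cX] := iidX.
have [K [K_homo mK PK]] := quantile_cells cX m0.
pose kappa w : {ffun 'I_n -> 'I_m} := [ffun i : 'I_n => K (X i.+1 w)].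
pose cell (k : {ffun 'I_n -> 'I_m}) i :=
  if insub i is Some i' then K @^-1` [set k i'] else setT.
have mcell k i : measurable (cell k i) by rewrite /cell; case: insubP.
have kappaE k : kappa @^-1` [set k] =
    \bigcap_(i in `I_n) (X i.+1 @^-1` cell k i).
  apply/seteqP; split => [w /= <- i /= ilt|w H /=].
    by rewrite /cell insubT /= ffunE.
  apply/ffunP => i; rewrite ffunE; have := H i (ltn_ord i).
  by rewrite /cell valK.
have mkappa k : measurable (kappa @^-1` [set k]).
  rewrite kappaE; apply: bigcap_measurableType => i _; exact: measurable_funPTI.
have Pkappa k : (P (kappa @^-1` [set k]) <= ((m ^ n)%:R^-1)%:E)%E.
  rewrite kappaE independent_prefix//.
  rewrite natrX -exprVn -[X in _ ^+ X](card_ord n) -prodr_const -prodEFin.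
  apply: (@proj2 (0 <= \prod_(i < n) P (X i.+1 @^-1` cell k i))%E).
  elim/big_ind2 : _ => [||i _]; first by rewrite lee_fin.
    move=> x1 x2 y1 y2 [x10 x12] [y10 y12].
    by split; [exact: mule_ge0|exact: lee_pmul].
  split; first exact: measure_ge0.
  rewrite /cell valK; have := idX i.+1 1%N isT isT _ (mK (k i)).
  by rewrite /distribution /pushforward => ->.
pose rk (k : {ffun 'I_n -> 'I_m}) (t : 'I_n) :=
  #|[set j : 'I_n | (j <= t)%N && (k t <= k j)%N]%SET|.
pose good (k : {ffun 'I_n -> 'I_m}) :=
  injectiveb k && [forall t : 'I_n, rk k t == (r t).+1].
pose b (k : {ffun 'I_n -> 'I_m}) := ~~ injectiveb k || good k.
have sub : rank_of n @^-1` [set r] `<=` [set w | b (kappa w)].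
  move=> w /= wr; rewrite /b /good -wr.
  case: (boolP (injectiveb _)) => //= /injectiveP kI.
  apply/forallP => t; rewrite -rank_ofE relrankE; apply/eqP.
  apply: eq_card => j; rewrite !inE; congr (_ && _); rewrite !ffunE.
  (* Strict order survives the passage to cells: equal cells would, by injectivity, identify the two
     indices. *)
  apply/idP/idP => [|/K_homo//]; apply: contraTT; rewrite -ltNge => XX.
  rewrite -ltnNge ltn_neqAle (K_homo _ _ (ltW XX)) andbT.
  apply/negP => /eqP/val_inj e.
  have /kI jt : kappa w j = kappa w t by rewrite !ffunE.
  by rewrite jt ltxx in XX.
have le_P : (P (rank_of n @^-1` [set r]) <= P [set w | b (kappa w)])%E.
  apply: le_measure sub; rewrite inE; first exact: measurable_rank_of.
  exact: (measurable_finite b mkappa).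
apply: (le_trans le_P); have -> := probability_finite P mkappa b.
have le_S : ((\sum_(k | b k) P (kappa @^-1` [set k]))%R <=
    (\sum_(k | b k) ((m ^ n)%:R^-1 : R))%:E)%E.
  by rewrite -sumEFin; apply: lee_sum.
apply: (le_trans le_S).
rewrite sumr_const lee_fin -[_ *+ _]mulr_natl.
rewrite ler_pM2r ?invr_gt0 ?ltr0n ?expn_gt0 ?m0// ler_nat.
have -> : #|b| =
   #|~: [set k : {ffun 'I_n -> 'I_m} | injectiveb k]%SET :|:
     [set k | good k]%SET|.
  by apply: eq_card => k; rewrite !inE.
rewrite (leq_trans (leq_card_setU _ _))//.
apply: leq_add; last exact: card_inj_relranks.
by rewrite cardsCs finset.setCK card_inj_ffuns card_ffun !card_ord.
Qed.

Lemma rank_of_prob n (r : rank_vector n) :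
  P (rank_of n @^-1` [set r]) = ((n`!%:R)^-1)%:E.
Proof.
have fact0 : (0 : R) < n`!%:R by rewrite ltr0n fact_gt0.
pose p s := fine (P (rank_of n @^-1` [set s])).
have pE s : P (rank_of n @^-1` [set s]) = (p s)%:E.
  by rewrite fineK// fin_num_measure//; exact: measurable_rank_of.
have p_le s : p s <= n`!%:R^-1.
  apply/ler_addgt0Pl => e e0.
  (* This choice gives m > n^2/e, so the collision term is at most e. *)
  pose m := (Num.truncn ((n ^ 2)%:R / e)).+1.
  have m0 : (0 : R) < m%:R by rewrite ltr0n.
  have mn0 : (0 : R) < (m ^ n)%:R by rewrite ltr0n expn_gt0.
  have := @rank_vector_prob_le n m s isT; rewrite pE lee_fin => /le_trans.
  apply; rewrite natrD mulrDl; apply: lerD.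
    rewrite ler_pdivrMr// (@le_trans _ _ ((n ^ 2)%:R / m%:R * (m ^ n)%:R))//.
      rewrite mulrAC ler_pdivlMr// -!natrM ler_nat mulnBl leq_subLR mulnC.
      by rewrite [X in (_ <= X + _)%N]mulnC expn_le_ffact.
    rewrite ler_wpM2r ?ler0n// ler_pdivrMr// -ler_pdivrMl// mulrC.
    exact/ltW/truncnS_gt.
  rewrite ler_pdivrMr// ler_pdivlMl// -natrM ler_nat mulnC bin_ffact.
  exact: ffact_le_expn.
have sum1 : \sum_s p s = 1.
  have := probability_finite P (@measurable_rank_of n) predT.
  rewrite (_ : [set w | _] = setT) ?probability_setT; last exact/seteqP.
  under eq_bigr do rewrite pE.
  by rewrite sumEFin => -[].
rewrite pE; congr (_%:E); apply/eqP; rewrite eq_le p_le /=.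
(* Nonnegative terms with zero sum all vanish, so each probability attains its upper bound. *)
have : \sum_s (n`!%:R^-1 - p s) = 0.
  rewrite sumrB sum1 sumr_const card_rank_vector -[_ *+ _]mulr_natr.
  by rewrite mulVf ?subrr// gt_eqF.
move/eqP; rewrite psumr_eq0; last by move=> s _; rewrite subr_ge0.
by move=> /allP/(_ r (mem_index_enum r)) /=; rewrite subr_eq0 => /eqP ->.
Qed.

End RankVector.

(** * Optimal stopping on rank vectors *)

(* This is b_(s+1), with a real number c below all rewards instead of -oo. *)
Fixpoint stop_value (R : realFieldType) (U : nat -> nat -> R) (n : nat) (c : R)
    (s : nat) : R :=
  if s is s'.+1 then
    (n - s')%:R^-1 * \sum_(1 <= r < (n - s').+1)
                       Num.max (stop_value U n c s') (U (n - s')%N r)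
  else c.

Section OptimalStopping.
Context (R : realFieldType) (U : nat -> nat -> R) (n : nat) (c : R).
Context (Y : nat -> rank_vector n -> R).
Hypothesis YE : forall (t : 'I_n) r, Y t.+1 r = U t.+1 (r t).+1.
Local Notation w := (stop_value U n c).

(** Coordinates count from 0, so those with [i < t] are R_1, ..., R_t: this is the condition that
    {tau = t} belongs to the history up to t, read on rank vectors. *)
Definition adapted (tau : rank_vector n -> nat) :=
  forall t (r r' : rank_vector n),
    (forall i : 'I_n, (i < t)%N -> r i = r' i) ->
    tau r = t -> tau r' = t.

Let truncated (tau : rank_vector n -> nat) t :=
  \sum_r (if (tau r <= t)%N then Y (tau r) r else w (n - t)).

(** By adaptedness the event [t < tau r] does not depend on coordinate t, which may then be
    averaged: [w (n - t)] is the mean of the maximum over that coordinate. *)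
Lemma truncated_step tau (t : 'I_n) : adapted tau ->
  truncated tau t =
  \sum_r (if (tau r <= t)%N then Y (tau r) r
          else Num.max (w (n - t.+1)) (Y t.+1 r)).
Proof.
move=> ad; pose f r : R := (t < tau r)%:R.
pose h (j : 'I_t.+1) := Num.max (w (n - t.+1)) (U t.+1 j.+1).
have f_inv (r r' : rank_vector n) :
    (forall s, s != t -> r s = r' s) -> f r = f r'.
  move=> rr; suff E (r1 r2 : rank_vector n) :
      (forall s, s != t -> r1 s = r2 s) -> (tau r1 <= t)%N -> (tau r2 <= t)%N.
    rewrite /f !ltnNge; congr ((~~ _)%:R); apply/idP/idP; apply: E => // s st.
    by rewrite rr.
  move=> e le1; rewrite (@ad (tau r1) r1 r2)// => i il; apply: e.
  by apply/eqP => it; rewrite it ltnNge le1 in il.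
have wE : w (n - t) = t.+1%:R^-1 * \sum_j h j.
  rewrite -(subnSK (ltn_ord t)) /= subKn//.
  by rewrite big_add1 /= big_mkord.
have t0 : t.+1%:R != 0 :> R by rewrite pnatr_eq0.
have key : \sum_r f r * w (n - t) = \sum_r f r * h (r t).
  apply: (mulfI t0); rewrite (sum_rank_coord _ f_inv) -mulr_suml wE.
  by rewrite mulrCA mulVKf.
pose g r := if (tau r <= t)%N then Y (tau r) r else 0.
transitivity (\sum_r (g r + f r * w (n - t))).
  apply: eq_bigr => r _; rewrite /g /f leqNgt.
  by case: ltnP => _; rewrite ?mul1r ?mul0r ?add0r ?addr0.
rewrite big_split /= key -big_split /=.
apply: eq_bigr => r _; rewrite /g /f leqNgt /h YE.
by case: ltnP => _; rewrite ?mul1r ?mul0r ?add0r ?addr0.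
Qed.

Context (tau : rank_vector n -> nat).
Hypothesis tau_bounds : forall r, (0 < tau r <= n)%N.
Hypothesis tau_adapted : adapted tau.

Lemma truncated0 : truncated tau 0 = n`!%:R * w n.
Proof.
rewrite -card_rank_vector mulr_natl -sumr_const; apply: eq_bigr => r _.
by rewrite leqNgt; have /andP[-> _] := tau_bounds r; rewrite subn0.
Qed.

Lemma truncatedn : truncated tau n = \sum_r Y (tau r) r.
Proof. by apply: eq_bigr => r _; have /andP[_ ->] := tau_bounds r. Qed.

(** From t to t + 1, a vector already stopped contributes the same; for any other, the maximum in
    [truncated_step] is replaced by one of its two arguments. *)
Lemma stopping_sum_le : \sum_r Y (tau r) r <= n`!%:R * w n.
Proof.
rewrite -truncatedn -truncated0.
suff: forall t, (t <= n)%N -> truncated tau t <= truncated tau 0 by exact.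
elim=> [//|t IH] tn; apply: (le_trans _ (IH (ltnW tn))).
rewrite (truncated_step (Ordinal tn))//=; apply: ler_sum => r _.
have [le|lt] := leqP (tau r) t; first by rewrite leqW.
case: leqP => [le1|_]; last by rewrite le_max lexx.
have -> : tau r = t.+1 by apply/eqP; rewrite eqn_leq le1 lt.
by rewrite le_max lexx orbT.
Qed.

(** The hypotheses make [tau] choose the larger argument of the maximum at every step, so nothing is
    lost; being weak inequalities, they leave ties free. *)
Lemma stopping_sum_eq :
  (forall r (t : 'I_n), tau r = t.+1 -> w (n - t.+1) <= Y t.+1 r) ->
  (forall r (t : 'I_n), (t.+1 < tau r)%N -> Y t.+1 r <= w (n - t.+1)) ->
  \sum_r Y (tau r) r = n`!%:R * w n.
Proof.
move=> stop cont; rewrite -truncatedn -truncated0.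
suff: forall t, (t <= n)%N -> truncated tau t = truncated tau 0 by exact.
elim=> [//|t IH] tn; rewrite -(IH (ltnW tn)).
rewrite (truncated_step (Ordinal tn))//=; apply: eq_bigr => r _.
have [le|lt] := leqP (tau r) t; first by rewrite leqW.
have [le1|lt1] := leqP (tau r) t.+1.
  have e : tau r = t.+1 by apply/eqP; rewrite eqn_leq le1 lt.
  by rewrite e; apply/esym/max_idPr/(stop r (Ordinal tn)).
by apply/esym/max_idPl/(cont r (Ordinal tn)).
Qed.

End OptimalStopping.

(** * The history as a sigma-algebra of saturated sets *)

Section History.
Context d (T : measurableType d) (R : realType) (P : probability T R).
Variable X : nat -> {RV P >-> R}.

(** Sets saturated for equality of the first t ranks form a sigma-algebra containing the generators;
    conversely, such a set is a finite union of fibres of [rank_of X t]. *)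
Lemma historyP t (A : set T) : history X t A <->
  (forall w w', (forall s, (1 <= s <= t)%N -> relrank X s w = relrank X s w') ->
     A w -> A w').
Proof.
split=> [|AP].
  pose agree w w' :=
    forall s, (1 <= s <= t)%N -> relrank X s w = relrank X s w'.
  have agreeC w w' : agree w w' -> agree w' w by move=> a s /a.
  pose G : set (set T) := [set B | forall w w', agree w w' -> B w -> B w'].
  suff sub : history X t `<=` G by move=> /sub.
  apply: smallest_sub.
    split => [//|B GB w w' a [_ nB]|B GB w w' a [k _ Bk]].
      by split => // /(GB _ _ (agreeC _ _ a)).
    by exists k => //; exact: GB Bk.
  move=> _ [s /= st [B _ <-]] w w' a [_ Bw]; split => //.
  by rewrite /preimage /= -(a s st).
pose GG := \bigcup_(s in [set s | (1 <= s <= t)%N])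
  preimage_set_system setT (relrank X s) measurable.
rewrite /history /sigma_of -/GG.
have -> : A = \bigcup_(r in [set r | exists2 w, A w & rank_of X t w = r])
    rank_of X t @^-1` [set r].
  apply/seteqP; split => [w Aw|w' [r [w Aw <-] /= e]].
    by exists (rank_of X t w) => //; exists w.
  apply: AP Aw => -[//|s] st.
  by rewrite !(@rank_ofE _ _ _ _ X t _ (Ordinal st)) e.
apply: (@fin_bigcup_measurable _ (g_sigma_algebraType GG)) => [|r _].
  exact: (@finite_finset {dffun forall i : 'I_t, 'I_i.+1}).
rewrite rank_of_eq.
apply: (@fin_bigcap_measurable _ (g_sigma_algebraType GG)) => // i _.
apply: sub_sigma_algebra; exists i.+1; first by rewrite /= ltn_ord.
by exists [set (r i).+1] => //; rewrite setTI.
Qed.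

End History.

(** A search reads nothing beyond its first success; this is what makes the threshold rule
    adapted. *)
Lemma eq_find_prefix (A : Type) (x0 : A) (a b : pred A) s :
  (forall i, (i <= find a s)%N -> a (nth x0 s i) = b (nth x0 s i)) ->
  (find a s < size s)%N -> find b s = find a s.
Proof.
elim: s => [//|x s IH] /= ab; rewrite -(ab 0%N)//=.
by move: ab; case: (a x) => //= ab fs; congr _.+1; apply: IH => // i /(ab i.+1).
Qed.

(** Total in [t] through [insub]: rank 0 is the default when [t.-1] is not below [n]. *)
Definition rank_reward (R : realFieldType) (U : nat -> nat -> R) n t
    (r : rank_vector n) : R :=
  U t (oapp (fun i : 'I_n => (r i).+1) 0%N (insub t.-1)).

Lemma rank_rewardE (R : realFieldType) (U : nat -> nat -> R) n (t : 'I_n) r :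
  rank_reward U t.+1 r = U t.+1 (r t).+1.
Proof. by rewrite /rank_reward /= valK. Qed.

(** * The threshold rule on rank vectors *)

Section ThresholdRule.
Context (R : realFieldType) (U : nat -> nat -> R) (n : nat) (c : R).
Hypothesis c_lt : forall t r, (t <= n)%N -> (r <= n)%N -> c < U t r.
Hypothesis n_gt0 : (0 < n)%N.

Lemma rank_reward_gt t (r : rank_vector n) : (1 <= t <= n)%N ->
  c < rank_reward U t r.
Proof.
case: t => [//|t] /= tn; rewrite (rank_rewardE U (Ordinal tn)).
by apply: c_lt => //; exact: leq_trans (ltn_ord _) tn.
Qed.

Let exceeds (r : rank_vector n) t :=
  stop_value U n c (n - t) < rank_reward U t r.

Definition threshold_rule (r : rank_vector n) : nat :=
  (find (exceeds r) (iota 1 n)).+1.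

(** At t = n the threshold is [c], which is below every reward, so the search succeeds. *)
Lemma threshold_rule_bounds r : (0 < threshold_rule r <= n)%N.
Proof.
rewrite /threshold_rule /= -[ltnRHS](size_iota 1 n) -has_find.
apply/hasP; exists n; first by rewrite mem_iota add1n n_gt0 ltnSn.
by rewrite /exceeds subnn rank_reward_gt// n_gt0 leqnn.
Qed.

Lemma threshold_rule_stop r (t : 'I_n) : threshold_rule r = t.+1 ->
  stop_value U n c (n - t.+1) < rank_reward U t.+1 r.
Proof.
case=> ft; have := @nth_find _ 0%N (exceeds r) (iota 1 n).
by rewrite has_find size_iota ft nth_iota// add1n; apply.
Qed.

Lemma threshold_rule_continue r (t : 'I_n) : (t.+1 < threshold_rule r)%N ->
  rank_reward U t.+1 r <= stop_value U n c (n - t.+1).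
Proof.
rewrite ltnS => /(before_find 0%N).
by rewrite nth_iota// add1n /exceeds ltNge => /negbFE.
Qed.

Lemma threshold_rule_adapted : adapted threshold_rule.
Proof.
move=> t r r' rr' et; rewrite -[RHS]et; congr _.+1.
have /andP[_ fn] := threshold_rule_bounds r.
apply: (@eq_find_prefix _ 0%N) => [i fi|]; last by rewrite size_iota.
have ilt : (i < n)%N := leq_ltn_trans fi fn.
rewrite nth_iota// add1n /exceeds !(rank_rewardE U (Ordinal ilt)).
by rewrite (rr' (Ordinal ilt))// -et.
Qed.

End ThresholdRule.

(** * Transfer between rank vectors and the probability space *)

Section RankRewards.
Context d (T : measurableType d) (R : realType) (P : probability T R).
Variable X : nat -> {RV P >-> R}.
Hypothesis iidX : iid_continuous X.
Variable (U : nat -> nat -> R) (n : nat).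
Local Notation rank := (rank_of X n).
Local Notation Y := (observed_reward X U).

Lemma observed_rewardE (t : 'I_n) w : Y t.+1 w = rank_reward U t.+1 (rank w).
Proof. by rewrite rank_rewardE /observed_reward (rank_ofE _ _ t). Qed.

Lemma expectation_rank (g : rank_vector n -> R) :
  'E_P[fun w => g (rank w)]%E = (n`!%:R^-1 * \sum_r g r)%:E.
Proof.
rewrite (expectation_finite P (@measurable_rank_of _ _ _ _ X n)).
under eq_bigr do rewrite rank_of_prob// -EFinM.
by rewrite sumEFin -mulr_suml mulrC.
Qed.

(** A fibre of probability 1/n! > 0 is nonempty. *)
Lemma rank_of_surj r : exists w, rank w = r.
Proof.
apply: contrapT => /forallNP nr; have := rank_of_prob iidX r.
rewrite (_ : rank @^-1` _ = set0) ?measure0; last by apply/seteqP; split.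
by case=> /esym/eqP; rewrite invr_eq0 pnatr_eq0 -leqn0 leqNgt fact_gt0.
Qed.

Lemma pmass_observed_reward t z : (1 <= t <= n)%N ->
  pmass P Y t z = (t%:R^-1 * \sum_(1 <= r < t.+1) (U t r == z)%:R)%:E.
Proof.
case: t => [//|t] tn; pose i : 'I_n := Ordinal tn.
pose h (j : 'I_i.+1) : R := (U t.+1 j.+1 == z)%:R.
rewrite /pmass.
rewrite (_ : [set w | _] = [set w | U t.+1 (rank w i).+1 == z]); last first.
  apply/seteqP; split => w /=; rewrite (observed_rewardE i) rank_rewardE.
    by move=> ->.
  by move=> /eqP.
rewrite -expectation_indic; last first.
  exact: (measurable_finite (fun r : rank_vector n => U t.+1 (r i).+1 == z)
            (@measurable_rank_of _ _ _ _ X n)).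
rewrite (_ : \1__ = fun w => h (rank w i)); last first.
  apply/funext => w; rewrite indicE /h; congr (_%:R).
  have [bw|/negP bw] := boolP (_ == z); first by rewrite mem_set.
  by rewrite memNset.
rewrite (expectation_rank (fun r => h (r i))); congr (_%:E).
have t0 : t.+1%:R != 0 :> R by rewrite pnatr_eq0.
have n0 : n`!%:R != 0 :> R by rewrite pnatr_eq0 -lt0n fact_gt0.
(* With constant weight, [sum_rank_coord] says that a single coordinate is uniform. *)
have := @sum_rank_coord R n i (fun=> 1) h (fun _ _ _ => erefl).
rewrite sumr_const card_rank_vector; under eq_bigr do rewrite mul1r.
move=> e; apply: (mulfI t0); rewrite mulrCA e mulKf// mulVKf//.
by rewrite big_add1 /= big_mkord.
Qed.

Section Threshold.
Variables (y : nat -> seq R) (c : R).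
Hypothesis yP : distinct_points U n y.

Lemma sum_distinct_points t (g : R -> R) : (1 <= t <= n)%N ->
  (\sum_(z <- y t) (g z)%:E * pmass P Y t z)%E =
  (t%:R^-1 * \sum_(1 <= r < t.+1) g (U t r))%:E.
Proof.
move=> tn; have [yu yE] := yP tn.
under eq_bigr do rewrite pmass_observed_reward// -EFinM.
rewrite sumEFin; congr (_%:E).
under eq_bigr do rewrite mulrCA mulr_sumr.
rewrite -mulr_sumr exchange_big /=; congr (_ * _).
apply: eq_big_nat => r rt.
have Uy : U t r \in y t by rewrite yE map_f// mem_iota add1n.
rewrite (bigD1_seq _ Uy yu) /= eqxx mulr1 big1 ?addr0// => z.
by rewrite eq_sym => /negPf ->; rewrite mulr0.
Qed.

Hypothesis c_lt : forall t r, (t <= n)%N -> (r <= n)%N -> c < U t r.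

(** The index shifts by one: b_(s+1) belongs to s remaining observations. At s = 0 the values -oo
    and [c] differ, but already at s = 1 they agree: b_2 has no maximum, and a maximum with [c]
    changes no reward. *)
Lemma thresholdE s : (0 < s <= n)%N ->
  threshold P Y n y s.+1 = (stop_value U n c s)%:E.
Proof.
case: s => [//|s]; elim: s => [|s IH] sn.
  rewrite /= subn0 (sum_distinct_points id); last by rewrite leqnn andbT.
  congr (_ * _)%:E; apply: eq_big_nat => r /andP[r0 rn].
  by apply/esym/max_idPr/ltW/c_lt.
have -> : threshold P Y n y s.+3 = (\sum_(z <- y (n - s.+1)%N)
    maxe (threshold P Y n y s.+2) z%:E * pmass P Y (n - s.+1) z)%E.
  by rewrite [LHS]/= subnSK//.
rewrite IH; last by rewrite /= ltnW.
under eq_bigr do rewrite -EFin_max.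
by rewrite (sum_distinct_points (Num.max (stop_value U n c s.+1)))//; lia.
Qed.

End Threshold.
End RankRewards.

(** * Optimality in the original problem *)

Lemma problem_horizon_gt0 d (T : measurableType d) (R : realType)
    (P : probability T R) (X : nat -> {RV P >-> R}) nu U :
  problem X nu U -> (0 < nu)%N.
Proof.
case=> [//|N Nmax q _ NP _ _|N q eps m _ _ _ _ _ [[]]//].
(* The sample space has a point, where N takes a value between 1 and [Nmax]. *)
by have /andP[/leq_trans] := NP point; apply.
Qed.

(** Such a [c] is the real substitute for b_1 = -oo. *)
Lemma strict_lower_bound (R : realDomainType) (U : nat -> nat -> R) n :
  exists c, forall t r, (t <= n)%N -> (r <= n)%N -> c < U t r.
Proof.
exists (- (1 + \sum_(t < n.+1) \sum_(r < n.+1) `|U t r|)) => t r tn rn.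
rewrite ltrNl (@le_lt_trans _ _ `|U t r|)//; first by rewrite -normrN ler_norm.
rewrite addrC -ltrBlDr (@lt_le_trans _ _ `|U t r|) ?gtrBl//.
rewrite (bigD1 (Ordinal (tn : (t < n.+1)%N)))//=.
rewrite (bigD1 (Ordinal (rn : (r < n.+1)%N)))//=.
by rewrite -addrA lerDl addr_ge0// !sumr_ge0// => i _; rewrite sumr_ge0.
Qed.

Theorem corollary2 (d : measure_display) (T : measurableType d) (R : realType)
    (P : probability T R) (X : nat -> {RV P >-> R})
    (nu : nat) (U : nat -> nat -> R) (y : nat -> seq R) :
  iid_continuous X ->
  problem X nu U ->
  distinct_points U nu y ->
  let Y := observed_reward X U in
  (forall t z, (1 <= t <= nu)%N -> z \in y t ->
     pmass P Y t z = (t%:R^-1 * \sum_(1 <= r < t.+1) (U t r == z)%:R)%:E) /\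
  ('E_P[stopped Y (tau_star P Y nu y)] =
     ereal_sup [set 'E_P[stopped Y tau] | tau in stopping_times X nu])%E /\
  ereal_sup [set ('E_P[stopped Y tau])%E | tau in stopping_times X nu] =
     threshold P Y nu y nu.+1.
Proof.
move=> iidX /problem_horizon_gt0 nu0 yP Y.
split=> [t z tnu _|]; first exact: pmass_observed_reward tnu.
have [c c_lt] := strict_lower_bound U nu.
pose rank := rank_of X nu; pose g := @rank_reward _ U nu.
have n0 : nu`!%:R != 0 :> R by rewrite pnatr_eq0 -lt0n fact_gt0.
have stoppedE (f : rank_vector nu -> nat) tau :
    (forall r, (0 < f r <= nu)%N) -> (forall w, tau w = f (rank w)) ->
    'E_P[stopped Y tau]%E = (nu`!%:R^-1 * \sum_r g (f r) r)%:E.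
  move=> f_bounds tauE; rewrite -(expectation_rank iidX (fun r => g (f r) r)).
  congr expectation; apply/funext => w; rewrite /stopped tauE.
  have := f_bounds (rank w); case: (f _) => [//|t] tn.
  exact: (observed_rewardE X U (Ordinal tn) w).
rewrite (thresholdE iidX yP c_lt) ?nu0 ?leqnn//.
pose rule := @threshold_rule _ U nu c.
have tau_starE w : tau_star P Y nu y w = rule (rank w).
  congr _.+1; apply: eq_in_find => t; rewrite mem_iota => /andP[t0 tn].
  have -> : Y t w = g t (rank w).
    case: t t0 tn => [//|t] _ tn.
    exact: (observed_rewardE X U (Ordinal (tn : (t < nu)%N)) w).
  (* At t = nu the threshold is -oo on one side and [c] on the other; the reward exceeds both. *)
  have [e|tnu] := eqVneq t nu.
    by rewrite e subnn /= ltNyr (rank_reward_gt c_lt)// nu0 leqnn.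
  rewrite (thresholdE iidX yP c_lt) ?lte_fin//; lia.
have rule_bounds := threshold_rule_bounds c_lt nu0.
have starE : 'E_P[stopped Y (tau_star P Y nu y)]%E = (stop_value U nu c nu)%:E.
  rewrite (stoppedE _ _ rule_bounds tau_starE); congr (_%:E).
  rewrite (stopping_sum_eq (c := c) (U := U) (@rank_rewardE _ U nu)) ?mulKf//.
  - exact: threshold_rule_adapted.
  - by move=> r t /threshold_rule_stop/ltW.
  - exact: threshold_rule_continue.
have star_stopping : stopping_times X nu (tau_star P Y nu y).
  split=> [w|t tn]; first by rewrite tau_starE.
  apply/historyP => w w' ww' /=; rewrite !tau_starE.
  apply: threshold_rule_adapted => // i it.
  by apply/val_inj/succn_inj; rewrite -!rank_ofE ww'.
suff -> : ereal_sup [set 'E_P[stopped Y tau] | tau in stopping_times X nu]%E =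
    (stop_value U nu c nu)%:E by [].
apply/eqP; rewrite eq_le; apply/andP; split; last first.
  by rewrite -starE; apply: ereal_sup_ubound; exists (tau_star P Y nu y).
apply: ge_ereal_sup => _ [tau [tau_bounds tau_hist] <-].
(* One outcome is chosen for each rank vector; a stopping time depends on the ranks alone, so it
   factors as [f] after [rank]. *)
have /choice[wit witE] := rank_of_surj iidX (n := nu).
have tau_of_rank (t : nat) w w' :
    (forall i : 'I_nu, (i < t)%N -> rank w i = rank w' i) ->
    tau w = t -> tau w' = t.
  move=> ww' tw; have tn : (1 <= t <= nu)%N by rewrite -tw.
  have /historyP := tau_hist t tn; apply; last exact: tw.
  case=> [//|s] st; have sn : (s < nu)%N by lia.
  by rewrite !(rank_ofE _ _ (Ordinal sn)) ww'.
pose f r := tau (wit r).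
have tauE w : tau w = f (rank w).
  by apply: tau_of_rank erefl => i _; rewrite /rank witE.
have f_adapted : adapted f.
  move=> t r r' rr'; apply: (tau_of_rank t (wit r) (wit r')) => i it.
  by rewrite /rank !witE; exact: rr'.
have f_bounds r : (0 < f r <= nu)%N by exact: tau_bounds.
rewrite (stoppedE f tau f_bounds tauE) lee_fin.
rewrite ler_pdivrMl ?ltr0n ?fact_gt0//.
exact: (@stopping_sum_le _ U nu c g (@rank_rewardE _ U nu) f).
Qed.
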